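(* For every $k\ge3$ and $d\ge3$, $$\delta_{\mathrm{IMF}}(u)\le\delta_{\mathrm{SMF}}(u)\qquad\text{for every }u\ge u_{\mathrm{SMF}}=2\sqrt d.$$
   Context: $\rho:=\sqrt{k/(2(k-1))}$, $\Lambda:=2\rho^2-1=1/(k-1)$; $H_j$ physicists' Hermite polynomials; $c_j:=(2^jj!\sqrt\pi)^{-1/2}$; $\mu_m:=\int_{\mathbb R}H_m(y)e^{-y^2/2}dy$; $\alpha_d:=\tfrac12\sqrt{d/2}\,c_{d-1}c_d\mu_d$ for $d$ even, $\alpha_d:=1/\mu_{d-1}$ for $d$ odd; $0!!=1$; $$\beta_d:=\sum_{j=0}^{d-1}c_j^2\,2^j\Big(\frac{(2j)!}{j!}\Big)^2+\sqrt{d/2}\,c_{d-1}c_d\,\frac{(2d-2)!}{(d-1)!}\,2^{d-1}\,\widetilde B_d,$$ $$\widetilde B_d:=\max\Big(\frac{(2d)!\,2^{d+1}}{d!},\ \frac{(2d)!}{d!}\int_0^\infty(1+y)^de^{-y^2/2}\,dy\Big),$$ $$\Phi_d(\rho,u):=\sum_{j=0}^{\lfloor (d-2)/2\rfloor}2\rho(2\Lambda)^j\frac{(d-2)!!}{(d-2j-2)!!}(2\rho u)^{d-2j-2}+\frac{\mathbf 1_{\{d\text{ odd}\}}}{u}(2\Lambda)^{\frac{d-1}{2}}(d-2)!!,$$ $$\Psi_d(\rho,u):=\frac{c_0^2}{(1+\rho^2)u}+\sum_{j=1}^{d-1}c_j^2\frac{(2\rho)^{2j}u^{2j-1}}{1+\rho^2-(2j-1)/u^2},$$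 $$\delta_{\mathrm{IMF}}(u):=2(k-1)^{\frac{d-1}{2}}\big(\alpha_d\Phi_d(\rho,u)e^{-u^2/2}+\Psi_d(\rho,u)e^{-(1+\rho^2)u^2/2}\big),$$ $$\delta_{\mathrm{SMF}}(u):=4\alpha_d(2k)^{\frac{d-1}{2}}u^{d-2}e^{-u^2/2}+2^d\beta_d(k-1)^{\frac{d-1}{2}}u^{2d-3}e^{-3u^2/4}.$$ *)

(* Defs.v *)
(* World: MathComp, with MathComp-Analysis. *)
From HB Require Import structures.
From mathcomp Require Import all_boot all_order all_algebra.
From mathcomp Require Import all_classical all_reals all_analysis.
Set Implicit Arguments.
Unset Strict Implicit.
Unset Printing Implicit Defensive.
Import Order.TTheory GRing.Theory Num.Theory.
Import numFieldNormedType.Exports.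
Local Open Scope classical_set_scope.
Local Open Scope ring_scope.

(* n!!, with 0!! = 1!! = 1. *)
Fixpoint dfact (n : nat) : nat :=
  match n with
  | 0 | 1 => 1
  | m.+2 => (m.+2 * dfact m)%N
  end.

Section Definitions.
Variable R : realType.

(* Physicists' Hermite polynomials.  The step H_(n+1) = 2X H_n - H_n' is what
   one gets by differentiating H_n(x) = (-1)^n e^(x^2) (d/dx)^n e^(-x^2). *)
Fixpoint hermite (n : nat) : {poly R} :=
  match n with
  | 0 => 1
  | m.+1 => 2%:P * 'X * hermite m - (hermite m)^`()
  end.

(* k is the order of the tensors and d their dimension. *)
Definition rho (k : nat) : R := Num.sqrt (k%:R / (2 * (k%:R - 1))).

Definition Lambda (r : R) : R := 2 * r ^+ 2 - 1.

Definition c (j : nat) : R :=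
  (2 ^+ j * j`!%:R * Num.sqrt pi) `^ (- (1 / 2)).

Definition mu (m : nat) : R :=
  \int[lebesgue_measure]_y ((hermite m).[y] * expR (- (y ^+ 2 / 2))).

Definition alpha (d : nat) : R :=
  if odd d then 1 / mu d.-1
  else 1 / 2 * Num.sqrt (d%:R / 2) * c d.-1 * c d * mu d.

Definition Btilde (d : nat) : R :=
  Num.max
    ((2 * d)`!%:R * 2 ^+ d.+1 / d`!%:R)
    ((2 * d)`!%:R / d`!%:R *
     \int[lebesgue_measure]_(y in `[0, +oo[)
       ((1 + y) ^+ d * expR (- (y ^+ 2 / 2)))).

Definition beta (d : nat) : R :=
  \sum_(0 <= j < d) c j ^+ 2 * 2 ^+ j * ((2 * j)`!%:R / j`!%:R) ^+ 2
  + Num.sqrt (d%:R / 2) * c d.-1 * c d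
    * ((2 * d - 2)`!%:R / d.-1`!%:R) * 2 ^+ d.-1 * Btilde d.

(* For d >= 2 and j <= floor((d-2)/2) no natural-number subtraction here
   truncates. *)
Definition Phi (d : nat) (r u : R) : R :=
  \sum_(0 <= j < ((d - 2)./2).+1)
    (2 * r * (2 * Lambda r) ^+ j
     * ((dfact (d - 2))%:R / (dfact (d - 2 * j - 2))%:R)
     * (2 * r * u) ^+ (d - 2 * j - 2))
  + (if odd d
     then 1 / u * (2 * Lambda r) ^+ (d.-1)./2 * (dfact (d - 2))%:R
     else 0).

Definition Psi (d : nat) (r u : R) : R :=
  c 0 ^+ 2 / ((1 + r ^+ 2) * u)
  + \sum_(1 <= j < d)
      c j ^+ 2 * ((2 * r) ^+ (2 * j) * u ^+ (2 * j - 1)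
                  / (1 + r ^+ 2 - (2 * j - 1)%:R / u ^+ 2)).

Definition deltaIMF (k d : nat) (u : R) : R :=
  2 * (k%:R - 1) `^ ((d%:R - 1) / 2)
  * (alpha d * Phi d (rho k) u * expR (- (u ^+ 2 / 2))
     + Psi d (rho k) u * expR (- ((1 + rho k ^+ 2) * u ^+ 2 / 2))).

Definition deltaSMF (k d : nat) (u : R) : R :=
  4 * alpha d * (2 * k%:R) `^ ((d%:R - 1) / 2) * u ^+ (d - 2)
    * expR (- (u ^+ 2 / 2))
  + 2 ^+ d * beta d * (k%:R - 1) `^ ((d%:R - 1) / 2) * u ^+ (2 * d - 3)
    * expR (- (3 * u ^+ 2 / 4)).

Definition uSMF (d : nat) : R := 2 * Num.sqrt d%:R.

End Definitions.

(* Main.v *)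
(* Write x = 2 rho u and Lambda = 2 rho^2 - 1 = 1/(k-1).  Since u^2 >= 4d, consecutive
   terms of Phi_d decrease by a factor at least 2, so Phi_d is at most twice
   (2 rho)^(d-1) u^(d-2), and (k-1)^((d-1)/2) (2 rho)^(d-1) = (2k)^((d-1)/2);
   this compares the alpha_d-parts once alpha_d >= 0 is known, which reduces to
   mu_m >= 0 for m even.  The latter follows from mu_(m+2) = 2(m+1) mu_m, a
   consequence of int (p' - y p) e^(-y^2/2) dy = 0 for every polynomial p.  The
   denominators in Psi_d are at least 1, so Psi_d is at most u^(2d-3) times the
   first sum of beta_d, term by term; finally rho^2 >= 1/2 compares the Gaussian
   factors. *)
Require Import Defs.
From HB Require Import structures.
From mathcomp Require Import all_boot all_order all_algebra.
From mathcomp Require Import all_classical all_reals all_analysis.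
From mathcomp Require Import measurable_realfun zify ring lra.
Set Implicit Arguments.
Unset Strict Implicit.
Unset Printing Implicit Defensive.
Import Order.TTheory GRing.Theory Num.Theory.
Import numFieldNormedType.Exports.
Local Open Scope classical_set_scope.
Local Open Scope ring_scope.

Section HermiteMoments.
Variable R : realType.
Notation leb := (@lebesgue_measure R).
Implicit Types (p : {poly R}) (t y : R).

Lemma normr_horner_le_expR p t : 0 < t ->
  exists2 C, 0 <= C & forall y, `|p.[y]| <= C * expR (t * y ^+ 2).
Proof.
elim/poly_ind: p t => [|p a IH] t t0.
  by exists 0 => // y; rewrite horner0 normr0 mul0r.
have t20 : 0 < t / 2 by rewrite divr_gt0.
have [C C0 pC] := IH _ t20.
exists (C * (1 + 2 / t) + `|a|).
  by rewrite addr_ge0// mulr_ge0// addr_ge0// divr_ge0// ltW.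
move=> y; rewrite hornerMXaddC (le_trans (ler_normD _ _))// mulrDl lerD//; last first.
  rewrite ler_peMr// -expR0 ler_expR mulr_ge0 ?sqr_ge0// ltW//.
have -> : t * y ^+ 2 = t / 2 * y ^+ 2 + t / 2 * y ^+ 2 by field.
rewrite expRD mulrACA normrM ler_pM//.
have e1 : 1 <= expR (t / 2 * y ^+ 2) :> R.
  by rewrite -[leLHS]expR0 ler_expR mulr_ge0 ?sqr_ge0// ltW.
have y1 : `|y| <= 1 + y ^+ 2.
  by rewrite ler_norml; apply/andP; split; nra.
rewrite (le_trans y1)// mulrDl mul1r lerD//.
have {1}-> : y ^+ 2 = 2 / t * (t / 2 * y ^+ 2) by field; lra.
apply: ler_wpM2l; first by rewrite divr_ge0// ltW.
by rewrite (le_trans _ (expR_ge1Dx _))// lerDr.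
Qed.

Lemma normr_horner_gauss_le p : exists2 C, 0 <= C &
  forall y, `|p.[y] * expR (- (y ^+ 2 / 2))| <= C * expR (- (y ^+ 2 / 4)).
Proof.
have [C C0 pC] := @normr_horner_le_expR p 4^-1 ltac:(lra).
exists C => // y; rewrite normrM [X in _ * X]ger0_norm ?expR_ge0//.
have -> : - (y ^+ 2 / 4) = 4^-1 * y ^+ 2 + - (y ^+ 2 / 2) by field.
by rewrite expRD mulrA ler_wpM2r// expR_ge0.
Qed.

Lemma continuous_horner_gauss p :
  continuous (fun y => p.[y] * expR (- (y ^+ 2 / 2))).
Proof.
move=> y; apply: cvgM; first exact: continuous_horner.
apply: continuous_comp; last exact: continuous_expR.
apply: cvgN; apply: cvgMr_tmp; exact: exprn_continuous.
Qed.

Lemma integrable_gauss_quarter :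
  leb.-integrable setT (fun y => (expR (- (y ^+ 2 / 4)))%:E).
Proof.
have s0 : Num.sqrt 2 != 0 :> R by rewrite sqrtr_eq0 -ltNge.
have := integrableZl measurableT (normal_peak (Num.sqrt 2))^-1
  (integrable_normal_pdf 0 (Num.sqrt 2 : R)).
apply: eq_integrable => // y _; rewrite -EFinM normal_pdfE//.
rewrite mulKf ?gt_eqF ?normal_peak_gt0// /normal_fun subr0 sqr_sqrtr//.
by congr (expR _)%:E; field.
Qed.

Lemma integrable_horner_gauss p :
  leb.-integrable setT (fun y => (p.[y] * expR (- (y ^+ 2 / 2)))%:E).
Proof.
have [C C0 pC] := normr_horner_gauss_le p.
apply: (@le_integrable _ _ _ leb _ measurableT _ (fun y => (C * expR (- (y ^+ 2 / 4)))%:E)).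
- apply/measurable_EFinP; apply: continuous_measurable_fun.
  exact: continuous_horner_gauss.
- by move=> y _; rewrite /= lee_fin (le_trans (pC y))// ler_norm.
- exact: (@integrableZl _ _ _ _ _ measurableT C _ integrable_gauss_quarter).
Qed.

Lemma Rintegral_deriv_gauss p :
  \int[leb]_y ((p^`() - 'X * p).[y] * expR (- (y ^+ 2 / 2))) = 0.
Proof.
pose f y := (p^`() - 'X * p).[y] * expR (- (y ^+ 2 / 2)).
pose F y := p.[y] * expR (- (y ^+ 2 / 2)).
have dF y : is_derive y (1 : R) F (f y).
  rewrite /F /f; apply: trigger_derive.
  by rewrite !hornerE /GRing.scale /=; field.
have cf : continuous f by exact: continuous_horner_gauss.
have cF : continuous F by exact: continuous_horner_gauss.
have FTC (n : nat) : (\int[leb]_(y in `[(- n.+1%:R)%R, (n.+1%:R)%R]) (f y)%:E =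
    (F n.+1%:R - F (- n.+1%:R))%R%:E)%E.
  rewrite EFinB; apply: continuous_FTC2.
  - by rewrite gtrN.
  - by apply: continuous_subspaceT.
  - split => [y _||]; first by case: (dF y).
    + exact: cvg_at_right_filter (cF _).
    + exact: cvg_at_left_filter (cF _).
  - by move=> y _; rewrite derive1E; case: (dF y).
have F0 : (F n.+1%:R - F (- n.+1%:R)) @[n --> \oo] --> (0 : R).
  have [C C0 pC] := normr_horner_gauss_le p.
  have Fn (n : nat) y : y ^+ 2 = n.+1%:R ^+ 2 -> `|F y| <= C * 4 / n.+1%:R.
    move=> yn; rewrite (le_trans (pC y))// -mulrA ler_wpM2l// yn expRN.
    rewrite -[leRHS]invrK lef_pV2 ?posrE ?expR_gt0 ?invr_gt0 ?divr_gt0//.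
    rewrite (le_trans _ (expR_ge1Dx _))// invf_div ler_wpDl//.
    by rewrite ler_pM2r ?invr_gt0// expr2 ler_peMr// ler1n.
  apply: norm_cvg0.
  apply: (@squeeze_cvgr _ _ _ _ (fun=> 0) (fun n => C * 8 * n.+1%:R^-1)).
  - near=> n; rewrite normr_ge0 (le_trans (ler_normB _ _))//.
    have -> : C * 8 / n.+1%:R = C * 4 / n.+1%:R + C * 4 / n.+1%:R :> R.
      by rewrite -mulrDl -mulrDr; congr (_ * _ / _); ring.
    by rewrite lerD// Fn// sqrrN.
  - exact: cvg_cst.
  - rewrite -[X in _ --> X](mulr0 (C * 8)); apply: cvgMl_tmp.
    exact: cvg_harmonic.
have intf := integrable_horner_gauss (p^`() - 'X * p).
have [|||||_ _] := @dominated_convergence _ _ _ leb setT measurableT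
  (fun n => EFin \o (f \_ `[- n.+1%:R, n.+1%:R])) (EFin \o f)
  (fun y => `|(f y)%:E|%E).
- move=> n; apply/measurable_EFinP; apply/measurable_restrict => //.
  by apply: measurable_funTS; exact: continuous_measurable_fun.
- by apply/measurable_EFinP; exact: continuous_measurable_fun.
- apply: aeW => y _; apply: cvg_near_cst; near=> n.
  rewrite /= patchE mem_set//= in_itv/= -ler_norml.
  rewrite (@le_trans _ _ n%:R) ?ler_nat//; near: n.
  exact: nbhs_infty_ger.
- exact: integrable_abse.
- apply: aeW => y n _ /=; rewrite patchE; case: ifPn => // _.
  by rewrite lee_fin [leLHS](_ : _ = 0)//; exact: normr0.
under [X in X @ _ --> _]eq_fun => n.
  rewrite (_ : (EFin \o f \_ `[- n.+1%:R, n.+1%:R]) =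
    (EFin \o f) \_ `[- n.+1%:R, n.+1%:R]); last by rewrite restrict_EFin.
  rewrite -integral_mkcond /= FTC; over.
move=> cvgf; suff f0 : (\int[leb]_y (f y)%:E)%E = 0%E by rewrite /Rintegral f0.
apply: cvg_unique cvgf _ => //.
by apply: cvg_EFin F0; exact: nearW.
Unshelve. all: by end_near. Qed.

Lemma hermiteS n : hermite R n.+1 = 2%:P * 'X * hermite R n - (hermite R n)^`().
Proof. by []. Qed.

Lemma deriv_hermite n : (hermite R n.+1)^`() = n.+1%:R *: (2%:P * hermite R n).
Proof.
have dX : (2%:P * 'X)^`() = 2%:P :> {poly R} by rewrite derivM derivC derivX mul0r add0r mulr1.
elim: n => [|n IH].
  by rewrite hermiteS /= mulr1 derivB dX derivC deriv0 subr0 scale1r mulr1.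
rewrite hermiteS derivB derivM dX IH derivZ derivM derivC mul0r add0r.
rewrite -scalerAr -addrA -scalerBr mulrCA -mulrBr -hermiteS.
by rewrite [n.+2%:R]mulrS scalerDl scale1r.
Qed.

Lemma muSS n : mu R n.+2 = 2 * n.+1%:R * mu R n.
Proof.
have muS m : mu R m.+1 =
    \int[leb]_y ((hermite R m)^`().[y] * expR (- (y ^+ 2 / 2))).
  rewrite -[RHS]subr0 -[in RHS](mulr0 2) -[in RHS](Rintegral_deriv_gauss (hermite R m)).
  rewrite -RintegralZl//; last exact: integrable_horner_gauss.
  rewrite -RintegralB//; [|exact: integrable_horner_gauss|].
    rewrite /mu hermiteS; apply: eq_Rintegral => y _.
    by rewrite !(hornerM, hornerD, hornerN, hornerC, hornerX); ring.
  exact: (integrableZl measurableT _ (integrable_horner_gauss _)).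
rewrite muS deriv_hermite /mu -RintegralZl//; last exact: integrable_horner_gauss.
by apply: eq_Rintegral => y _; rewrite hornerZ hornerM hornerC; ring.
Qed.

Lemma mu_even_ge0 n : ~~ odd n -> 0 <= mu R n.
Proof.
move=> /even_halfK <-; elim: n./2 => [|m IH].
  by apply: Rintegral_ge0 => y _; rewrite hornerE mul1r expR_ge0.
by rewrite doubleS muSS mulr_ge0// mulr_ge0.
Qed.

End HermiteMoments.

Lemma dfact_gt0 n : (0 < dfact n)%N.
Proof.
suff: (0 < dfact n)%N && (0 < dfact n.+1)%N by case/andP.
by elim: n => // n /andP[n0 n1]; rewrite n1 /= muln_gt0.
Qed.

Lemma dfact_le m j : (2 * j <= m)%N -> (dfact m <= m ^ j * dfact (m - 2 * j))%N.
Proof.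
elim: j => [|j IH] jm; first by rewrite muln0 subn0 mul1n.
have jm' : (2 * j + 2 <= m)%N by rewrite -mulnSr.
rewrite (leq_trans (IH (leq_trans (leq_addr _ _) jm')))//.
rewrite expnSr -mulnA leq_mul2l; apply/orP; right.
have -> : (m - 2 * j)%N = (m - 2 * j.+1).+2.
  by rewrite mulnSr subnDA -[in RHS]addn2 subnK// leq_subRL ?(leq_trans (leq_addr _ _) jm').
rewrite leq_mul2r; apply/orP; right.
by rewrite -addn2 -{2}(subnK jm) leq_add2l mulnSr leq_addl.
Qed.

Section TailBounds.
Variable R : realType.
Implicit Types (r u x : R).

Lemma sum_geometric_half n : \sum_(0 <= j < n) (2^-1 : R) ^+ j = 2 - 2 * 2^-1 ^+ n.
Proof.
elim: n => [|n IH]; first by rewrite big_nil expr0; ring.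
by rewrite big_nat_recr//= IH exprS; field.
Qed.

Lemma Phi_le d r u : (2 <= d)%N -> 0 < r -> 0 < u -> 0 <= Lambda r ->
    2 * Lambda r * (d - 2)%:R <= (2 * r * u) ^+ 2 / 2 ->
  Phi d r u <= 2 * ((2 * r) ^+ d.-1 * u ^+ (d - 2)).
Proof.
case: d => [|[|m]]//= _ r0 u0 L0; rewrite /Phi subn2 /=.
set L := Lambda r in L0 *; set x := 2 * r * u => Ax.
have x0 : 0 < x by rewrite !mulr_gt0.
have A0 : 0 <= 2 * L * m%:R by rewrite !mulr_ge0.
have main j (e : R) : e <= m%:R ^+ j -> (2 * L) ^+ j * e <= x ^+ (2 * j) * 2^-1 ^+ j.
  move=> em; rewrite exprM -exprMn.
  rewrite (le_trans _ (lerXn2r j _ _ Ax)) ?nnegrE ?divr_ge0 ?sqr_ge0//.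
  by rewrite [leRHS]exprMn ler_wpM2l ?exprn_ge0 ?mulr_ge0.
have sumle : \sum_(0 <= j < m./2.+1) (2 * r * (2 * L) ^+ j
      * ((dfact m)%:R / (dfact (m.+2 - 2 * j - 2))%:R) * x ^+ (m.+2 - 2 * j - 2))
    <= 2 * r * x ^+ m * (2 - 2^-1 ^+ m./2).
  have -> : 2 - 2^-1 ^+ m./2 = \sum_(0 <= j < m./2.+1) 2^-1 ^+ j :> R.
    by rewrite sum_geometric_half exprS; field.
  rewrite mulr_sumr ler_sum_nat// => j /andP[_]; rewrite ltnS => jm.
  have {}jm : (2 * j <= m)%N.
    by rewrite mul2n -[leqRHS]odd_double_half (leq_trans _ (leq_addl _ _))// leq_double.
  have -> : (m.+2 - 2 * j - 2 = m - 2 * j)%N by rewrite subnAC subn2.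
  rewrite -!mulrA ler_pM2l// ler_pM2l// mulrA.
  have -> : x ^+ m * 2^-1 ^+ j = x ^+ (2 * j) * 2^-1 ^+ j * x ^+ (m - 2 * j).
    by rewrite -[in LHS](subnKC jm) exprD mulrAC.
  rewrite mulrA ler_wpM2r ?exprn_ge0 ?(ltW x0)//.
  rewrite -mulrA main// ler_pdivrMr ?ltr0n ?dfact_gt0//.
  by rewrite -natrX -natrM ler_nat dfact_le.
have -> : 2 * ((2 * r) ^+ m.+1 * u ^+ m) = 2 * r * x ^+ m * 2.
  by rewrite /x [in RHS]exprMn exprS; ring.
rewrite negbK; case: ifPn => [modd|_]; last first.
  rewrite addr0 (le_trans sumle)// ler_wpM2l ?mulr_ge0 ?exprn_ge0 ?ltW//.
  by rewrite ltrBlDr ltrDl exprn_gt0// invr_gt0.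
rewrite uphalf_half modd add1n.
have -> : 2 * r * x ^+ m * 2 = 2 * r * x ^+ m * (2 - 2^-1 ^+ m./2)
    + u^-1 * (x ^+ (2 * m./2.+1) * (2 * 2^-1 ^+ m./2.+1)).
  have -> : (2 * m./2.+1 = m.+1)%N.
    by rewrite mul2n doubleS -[in RHS](odd_double_half m) modd.
  rewrite !exprS -[x * x ^+ m]/(2 * r * u * x ^+ m); field; lra.
rewrite lerD// div1r -mulrA ler_wpM2l ?invr_ge0 ?(ltW u0)//.
rewrite (@le_trans _ _ (x ^+ (2 * m./2.+1) * 2^-1 ^+ m./2.+1))//; last first.
  rewrite ler_wpM2l ?exprn_ge0 ?(ltW x0)// ler_peMl ?exprn_ge0 ?invr_ge0// ler1n//.
rewrite main// -natrX ler_nat.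
have i2 : (2 * m./2 <= m)%N by rewrite mul2n -[leqRHS]odd_double_half leq_addl.
rewrite (leq_trans (dfact_le i2))//.
have -> : (m - 2 * m./2 = 1)%N by rewrite mul2n -[in X in (X - _)%N](odd_double_half m) modd addnK.
by rewrite muln1 leq_pexp2l// lt0n; apply: contraTneq modd => ->.
Qed.

Lemma powR_rho (k d : nat) : (3 <= k)%N -> (0 < d)%N ->
  (2 * k%:R : R) `^ ((d%:R - 1) / 2) =
  (k%:R - 1) `^ ((d%:R - 1) / 2) * (2 * rho R k) ^+ d.-1.
Proof.
move=> k3 d0; have k3R : 3 <= k%:R :> R by rewrite ler_nat.
have -> : 2 * k%:R = (k%:R - 1) * (2 * rho R k) ^+ 2 :> R.
  rewrite exprMn sqr_sqrtr ?divr_ge0//; last lra.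
  by field; lra.
rewrite powRM ?sqr_ge0//; last lra.
congr (_ * _); rewrite -powR_mulrn ?mulr_ge0 ?sqrtr_ge0// -powRrM.
rewrite -powR_mulrn ?mulr_ge0 ?sqrtr_ge0//; congr (_ `^ _).
by rewrite -subn1 natrB//; field.
Qed.

End TailBounds.

Section Comparison.
Variable R : realType.
Implicit Types (r u x : R).

Lemma alpha_ge0 d : 0 <= alpha R d.
Proof.
rewrite /alpha; case: ifPn => [dodd|deven].
  by rewrite div1r invr_ge0 mu_even_ge0//; case: d dodd.
by rewrite !mulr_ge0 ?powR_ge0 ?sqrtr_ge0 ?mu_even_ge0.
Qed.

Lemma Btilde_ge0 d : 0 <= Btilde R d.
Proof. by rewrite /Btilde le_max divr_ge0// mulr_ge0// exprn_ge0. Qed.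

Lemma beta_ge d :
  \sum_(0 <= j < d) c R j ^+ 2 * 2 ^+ j * ((2 * j)`!%:R / j`!%:R) ^+ 2 <= beta R d.
Proof.
by rewrite lerDl !mulr_ge0 ?powR_ge0 ?sqrtr_ge0 ?Btilde_ge0 ?exprn_ge0 ?invr_ge0.
Qed.

Lemma beta_ge0 d : 0 <= beta R d.
Proof.
apply: le_trans (beta_ge d); apply: sumr_ge0 => j _.
by rewrite !mulr_ge0 ?powR_ge0 ?exprn_ge0 ?invr_ge0.
Qed.

Lemma expn2_fact_le j : (2 ^ j * j`! <= (2 * j)`!)%N.
Proof.
elim: j => // j IH; rewrite expnS factS mulnACA.
have -> : (2 * j.+1 = (2 * j).+2)%N by rewrite mulnS.
by rewrite !factS [leqRHS]mulnA leq_mul// leq_pmulr.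
Qed.

Lemma Psi_le d r u : (2 <= d)%N -> 1 <= 2 * r ^+ 2 -> r ^+ 2 <= 1 ->
    1 <= u -> 4 * d%:R <= u ^+ 2 ->
  Psi d r u <= u ^+ (2 * d - 3) *
    \sum_(0 <= j < d) c R j ^+ 2 * 2 ^+ j * ((2 * j)`!%:R / j`!%:R) ^+ 2.
Proof.
move=> d2 r1 r2 u1 ud; have u0 : 0 < u by lra.
have upow n : (n <= 2 * d - 3)%N -> u ^+ n <= u ^+ (2 * d - 3) by exact: ler_weXn2l.
rewrite big_ltn ?(leq_trans _ d2)// mulrDr mulr_sumr /Psi lerD//.
  rewrite expr0 mulr1 muln0 fact0 divr1 expr1n mulr1 mulrC ler_wpM2r ?sqr_ge0//.
  rewrite (@le_trans _ _ 1)// ?exprn_ege1// invf_le1 ?mulr_gt0//; first by nra.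
  by nra.
rewrite ler_sum_nat// => j /andP[j1 jd].
rewrite -[X in _ <= _ * X]mulrA [leRHS]mulrCA ler_wpM2l ?sqr_ge0//.
have dd : 2^-1 * u ^+ 2 >= (2 * j - 1)%:R.
  rewrite (@le_trans _ _ (2 * d%:R))//; last lra.
  by rewrite -natrM ler_nat (leq_trans (leq_subr _ _))// leq_mul// ltnW.
have den : 1 <= 1 + r ^+ 2 - (2 * j - 1)%:R / u ^+ 2.
  suff : (2 * j - 1)%:R / u ^+ 2 <= 2^-1 by lra.
  by rewrite ler_pdivrMr ?exprn_gt0.
rewrite ler_pdivrMr; last lra.
rewrite (@le_trans _ _ (u ^+ (2 * d - 3) * (2 ^+ j * ((2 * j)`!%:R / j`!%:R) ^+ 2)))//; last first.
  by rewrite ler_peMr// !mulr_ge0// ?exprn_ge0 ?invr_ge0// ltW.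
rewrite mulrC; apply: ler_pM.
- by rewrite exprn_ge0// ltW.
- by rewrite exprM exprn_ge0// sqr_ge0.
- by rewrite upow//; lia.
have fj : 2 ^+ j <= (2 * j)`!%:R / j`!%:R :> R.
  by rewrite ler_pdivlMr ?ltr0n ?fact_gt0// -natrX -natrM ler_nat expn2_fact_le.
rewrite (@le_trans _ _ ((2 ^+ j) ^+ 2))//.
  rewrite -[leRHS]exprM [in leRHS]mulnC !exprM lerXn2r ?nnegrE ?sqr_ge0//.
  by rewrite exprMn ler_piMr// sqr_ge0.
rewrite (@le_trans _ _ (((2 * j)`!%:R / j`!%:R) ^+ 2))//.
  by rewrite lerXn2r// nnegrE ?exprn_ge0// divr_ge0.
by rewrite ler_peMl ?sqr_ge0// exprn_ege1// ler1n.
Qed.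

End Comparison.

Theorem theorem7 (R : realType) (k d : nat) (hk : (3 <= k)%N) (hd : (3 <= d)%N)
  (u : R) (hu : uSMF R d <= u) :
  deltaIMF k d u <= deltaSMF k d u.
Proof.
have k3 : 3 <= k%:R :> R by rewrite ler_nat.
have d3 : 3 <= d%:R :> R by rewrite ler_nat.
have d0 : (0 < d)%N by apply: leq_trans hd.
have sd0 : 0 <= Num.sqrt d%:R :> R := sqrtr_ge0 _.
have ud : 4 * d%:R <= u ^+ 2.
  rewrite -[d%:R]sqr_sqrtr//; move: hu; rewrite /uSMF; nra.
have u1 : 1 <= u.
  have : 0 <= u by apply: le_trans hu; rewrite mulr_ge0.
  nra.
set r := rho R k.
have r2 : 2 * r ^+ 2 * (k%:R - 1) = k%:R.
  by rewrite sqr_sqrtr; [field; lra|rewrite divr_ge0//; lra].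
have r0 : 0 < r by rewrite sqrtr_gt0 divr_gt0//; lra.
have rge : 1 <= 2 * r ^+ 2 by nra.
have rle : r ^+ 2 <= 3 / 4 by nra.
rewrite /deltaIMF /deltaSMF -/r powR_rho// -/r.
set K := (k%:R - 1) `^ _; have K0 : 0 <= K by exact: powR_ge0.
rewrite mulrDr lerD//.
  rewrite !mulrA ler_wpM2r ?expR_ge0//.
  have -> : 4 * alpha R d * K * (2 * r) ^+ d.-1 * u ^+ (d - 2) =
    2 * K * alpha R d * (2 * ((2 * r) ^+ d.-1 * u ^+ (d - 2))) by ring.
  rewrite ler_wpM2l ?mulr_ge0 ?alpha_ge0// Phi_le ?(leq_trans _ hd)//.
  + lra.
  + by rewrite /Lambda; lra.
  + rewrite /Lambda natrB ?(leq_trans _ hd)//; nra.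
pose Y := u ^+ (2 * d - 3) * beta R d.
have Y0 : 0 <= Y by rewrite mulr_ge0 ?beta_ge0// exprn_ge0//; lra.
have PsiY : Psi d r u <= Y.
  apply: le_trans (Psi_le _ _ _ u1 ud) _ => //; [exact: leq_trans hd|lra|].
  by rewrite ler_wpM2l ?beta_ge// exprn_ge0//; lra.
have -> : 2 ^+ d * beta R d * K * u ^+ (2 * d - 3) = K * (2 ^+ d * Y).
  by rewrite /Y; ring.
move: (Y) Y0 PsiY => {}Y Y0 PsiY.
rewrite [2 * K]mulrC -!mulrA ler_wpM2l// !mulrA.
have D2 : 2 <= 2 ^+ d :> R by rewrite -[leLHS]expr1 ler_weXn2l// ler1n.
apply: le_trans (ler_wpM2r (expR_ge0 _) (_ : _ <= 2 ^+ d * Y)) _.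
  by rewrite (le_trans (ler_wpM2l _ PsiY))// ler_wpM2r.
apply: ler_wpM2l; first by rewrite mulr_ge0// exprn_ge0.
by rewrite ler_expR lerN2; nra.
Qed.
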